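(* Let $R$ be a semiring and $V$ an $R$-module. Assume that $W,T$ are submodules of $V$ with $V = W + T$, where $T$ is summand absorbing in $V$, and $W \cap T = \{0_V\}$. (i) Then $T$ is the unique weak complement of $W$ in $V$. (ii) If in addition $U$ is a submodule of $V$ with $W + U = V$ and $U$ is also summand absorbing in $V$, then $T \subset U$, and $T$ is the unique weak complement of $W \cap U$ in $U$.
   Context: A semiring $(R,+,\cdot,0_R,1_R)$: $(R,+,0_R)$ is a commutative monoid, $(R,\cdot,1_R)$ is a (not necessarily commutative) monoid, and multiplication distributes over addition. A (left) $R$-module $V$ is a commutative monoid $(V,+,0_V)$ with scalar multiplication $R\times V\to V$ such that $r(v+w)=rv+rw$, $(r_1+r_2)v=r_1v+r_2v$, $(r_1r_2)v=r_1(r_2v)$, $1_Rv=v$, and $0_Rv=r0_V=0_V$. No subtraction is assumed. A subset $S$ of $V$ is summand absorbing (SA) in $V$ if for all $x,y\in V$, $x+y\in S$ implies $x\in S$ and $y\in S$. For a module $X$ and submodules $A,B\subset X$, $B$ is a weak complement of $A$ in $X$ if $A+B=X$ and $(a+B)\cap B=\emptyset$ for all $a\in A\setminus\{0_V\}$. *)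

(* Defs.v *)
From HB Require Import structures.
From mathcomp Require Import all_boot all_algebra.
From mathcomp Require Import boolp classical_sets.

Set Implicit Arguments.
Unset Strict Implicit.
Unset Printing Implicit Defensive.

Import GRing.Theory.

Local Open Scope ring_scope.

(* Unlike pzSemiRingType, this structure does not require 0 to be absorbing:
   0 * r = r * 0 = 0 is not among the axioms. Hence it joins the additive
   Nmodule with the multiplicative Monoid (operations 1%g and *%g) instead of
   reusing pzSemiRingType. *)
HB.mixin Record NmoduleMonoid_isSemiring R of GRing.Nmodule R & Monoid R := {
  smulDl : forall x y z : R, ((x + y)%R * z)%g = (x * z)%g + (y * z)%g;
  smulDr : forall x y z : R, (x * (y + z)%R)%g = (x * y)%g + (x * z)%g
}.

#[short(type="semiringType")]
HB.structure Definition Semiring :=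
  {R of GRing.Nmodule R & Monoid R & NmoduleMonoid_isSemiring R}.

(* lSemiModType is only available over a pzSemiRingType, where r 0 = 0 is
   derived from absorption; here it is an axiom. *)
HB.mixin Record Nmodule_isLeftModule (R : semiringType) V of GRing.Nmodule V := {
  act : R -> V -> V;
  actDr : forall (r : R) (v w : V), act r (v + w) = act r v + act r w;
  actDl : forall (r s : R) (v : V), act (r + s) v = act r v + act s v;
  actA : forall (r s : R) (v : V), act (r * s)%g v = act r (act s v);
  act1 : forall v : V, act 1%g v = v;
  act0l : forall v : V, act 0 v = 0;
  act0r : forall r : R, act r 0 = 0
}.

#[short(type="leftModType")]
HB.structure Definition LeftModule (R : semiringType) :=
  {V of GRing.Nmodule V & Nmodule_isLeftModule R V}.

Local Open Scope classical_set_scope.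

Definition submodule (R : semiringType) (V : leftModType R) (S : set V) : Prop :=
  [/\ S 0,
      forall x y : V, S x -> S y -> S (x + y)
    & forall (r : R) (x : V), S x -> S (act r x)].

Definition summand_absorbing (V : nmodType) (S : set V) : Prop :=
  forall x y : V, S (x + y) -> S x /\ S y.

Definition set_add (V : nmodType) (A B : set V) : set V :=
  [set a + b | a in A & b in B].

(* The ambient module X is a submodule of V, with X = setT for V itself. *)
Definition weak_complement (R : semiringType) (V : leftModType R)
    (X A B : set V) : Prop :=
  [/\ [/\ submodule X, submodule A & submodule B],
      A `<=` X,
      B `<=` X,
      set_add A B = X
    & forall a : V, A a -> a <> 0 -> [set a + b | b in B] `&` B = set0].

Definition unique_weak_complement (R : semiringType) (V : leftModType R)
    (X A B : set V) : Prop :=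
  weak_complement X A B /\ forall C : set V, weak_complement X A C -> C = B.

(* Main.v *)
Require Import Defs.
From mathcomp Require Import all_boot all_algebra.
From mathcomp Require Import boolp classical_sets.

Local Open Scope ring_scope.
Local Open Scope classical_set_scope.

(** Absorption stands in for subtraction: if [a + t] lies in [T] with [a] in [A], then [a] lies in
    [A] ∩ [T], so [a = 0]. Hence nonzero translates of [T] miss [T], and [T] is contained in every
    [C] with [A + C] ⊇ [T]. Disjointness of the translates of [C] gives the reverse inclusion. *)

(* Writing t in T as t = a + c puts a in T, since T is summand absorbing. *)
Lemma summand_absorbing_sub (V : nmodType) (A T C : set V) :
    summand_absorbing T -> A `&` T = [set (0 : V)] -> T `<=` set_add A C ->
  T `<=` C.
Proof.
move=> saT AT0 TAC t Tt; have [a Aa [c Cc acE]] := TAC t Tt.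
have Ta : T a by have [] := saT a c; rewrite ?acE.
have a0 : a = 0 by have : (A `&` T) a by []; rewrite AT0.
by rewrite -acE a0 GRing.add0r.
Qed.

(** The ambient [X] is kept general so that both parts are instances: [V] with [W], and [U] with [W]
    ∩ [U]. *)
Lemma summand_absorbing_unique_weak_complement (R : semiringType)
    (V : leftModType R) (X A T : set V) :
    submodule X -> submodule A -> submodule T -> A `<=` X -> T `<=` X ->
    set_add A T = X -> summand_absorbing T -> A `&` T = [set (0 : V)] ->
  unique_weak_complement X A T.
Proof.
move=> subX subA subT AX TX ATX saT AT0; split.
  split=> // a Aa a_neq0; rewrite -subset0 => x [[t Tt <-] Tat].
  have [Ta _] := saT a t Tat.
  by apply: a_neq0; have : (A `&` T) a by []; rewrite AT0.
move=> C [_ _ CX ACX disjC].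
have TC : T `<=` C by apply: (@summand_absorbing_sub V A) => //; rewrite ACX.
apply/seteqP; split=> // c Cc.
have [a Aa [t Tt atE]] : set_add A T c by rewrite ATX; exact: CX.
have [a0|a_neq0] := pselect (a = 0).
  by rewrite -atE a0 GRing.add0r.
(* Since [t] is also in [C], the element [c = a + t] lies in both [a + C] and [C], impossible for
   [a <> 0]. *)
have : ([set a + b | b in C] `&` C) c by split=> //; exists t => //; exact: TC.
by rewrite disjC.
Qed.

Theorem theorem4p5 (R : semiringType) (V : leftModType R) (W T : set V)
    (subW : submodule W) (subT : submodule T)
    (VWT : set_add W T = [set: V])
    (saT : summand_absorbing T)
    (WT0 : W `&` T = [set (0 : V)]) :
  unique_weak_complement [set: V] W T /\
  (forall U : set V, submodule U -> set_add W U = [set: V] ->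
     summand_absorbing U ->
     T `<=` U /\ unique_weak_complement U (W `&` U) T).
Proof.
split; first exact: summand_absorbing_unique_weak_complement.
move=> U subU WUV saU.
have TU : T `<=` U by apply: (@summand_absorbing_sub V W) => //; rewrite WUV.
split=> //; apply: summand_absorbing_unique_weak_complement => //.
- case: subW subU => W0 WD WZ [U0 UD UZ]; split=> //.
    by move=> x y [Wx Ux] [Wy Uy]; split; [exact: WD | exact: UD].
  by move=> r x [Wx Ux]; split; [exact: WZ | exact: UZ].
(* For [U] ⊆ [(W ∩ U) + T], split [u = w + t] in [V]; absorption of [U] forces [w] into [U]. *)
- apply/seteqP; split=> [_ [w [Ww Uw] [t Tt <-]]|u Uu].
    by case: subU => _ UD _; apply: UD => //; exact: TU.
  have [w Ww [t Tt wtE]] : set_add W T u by rewrite VWT.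
  have [Uw _] : U w /\ U t by apply: saU; rewrite wtE.
  by exists w => //; exists t.
- by rewrite -setIA (setIidr TU).
Qed.
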